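(* Let $(R,\mathfrak m)$ be a Cohen–Macaulay local ring of dimension one and type $r(R)=r$, and assume that $R$ is not a discrete valuation ring. Let $Q$ be the total ring of fractions of $R$. Then $$A=\mathrm{Hom}_R(\mathfrak m,\mathfrak m)=\mathfrak m:_Q\mathfrak m=x^{-1}\cdot\bigl((x):_R\mathfrak m\bigr)$$ for any regular element $x\in\mathfrak m$. Furthermore, $\nu_R(A)=r+1$.
   Context: For submodules $M,N\subseteq Q$, $M:_QN=\{q\in Q: qN\subseteq M\}$, and $(x):_R\mathfrak m=\{b\in R: b\mathfrak m\subseteq xR\}$. $\mathrm{Hom}_R(\mathfrak m,\mathfrak m)$ is identified with $\mathfrak m:_Q\mathfrak m$. $\nu_R(M)$ is the minimal number of generators of the $R$-module $M$. The type $r(R)$ is the Cohen–Macaulay type of $R$. *)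

(* Defs.v *)
From HB Require Import structures.
From mathcomp Require Import all_boot all_order all_algebra.
From mathcomp Require Import boolp classical_sets functions.

Set Implicit Arguments.
Unset Strict Implicit.
Unset Printing Implicit Defensive.

Import GRing.Theory.
Local Open Scope classical_set_scope.
Local Open Scope ring_scope.

Section Modules.
Variables (R : comNzRingType) (V : lmodType R).

Definition submodule (M : set V) : Prop :=
  [/\ M 0, forall u v, M u -> M v -> M (u + v)
    & forall (a : R) u, M u -> M (a *: u)].

Definition rspan (n : nat) (v : 'I_n -> V) : set V :=
  [set w | exists a : 'I_n -> R, w = \sum_i a i *: v i].

Definition generated_by (M : set V) (n : nat) : Prop :=
  exists v : 'I_n -> V, M = rspan v.

Definition min_gens (M : set V) (n : nat) : Prop :=
  generated_by M n /\ forall k, generated_by M k -> (n <= k)%N.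

(* For submodules B <= Z with m Z <= B: b induces a basis of Z / B over R / m. *)
Definition residue_basis (m : set R) (Z B : set V) (r : nat) (b : 'I_r -> V) :
    Prop :=
  [/\ forall i, Z (b i),
      forall z, Z z -> exists a : 'I_r -> R, B (z - \sum_i a i *: b i)
    & forall a : 'I_r -> R, B (\sum_i a i *: b i) -> forall i, m (a i)].

Definition residue_dim (m : set R) (Z B : set V) (r : nat) : Prop :=
  exists b : 'I_r -> V, residue_basis m Z B b.

End Modules.

(* Linearity without building sums in the submodule M: w ranges over the
   elements of M equal to a *: u + v. *)
Definition lin_hom (R : comNzRingType) (V W : lmodType R)
    (M : set V) (N : set W) : set (M -> N) :=
  [set f | forall (a : R) (u v w : M), \val w = a *: \val u + \val v ->
    \val (f w) = a *: \val (f u) + \val (f v)].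

Definition colon (S : comNzRingType) (M N : set S) : set S :=
  [set q | forall y, N y -> M (q * y)].

Section Rings.
Variable R : comNzRingType.

Definition ideal (I : set R) : Prop := @submodule R R^o I.

Definition principal (x : R) : set R := [set x * c | c in [set: R]].

Definition prime_ideal (P : set R) : Prop :=
  [/\ ideal P, ~ P 1 & forall a b, P (a * b) -> P a \/ P b].

Definition maximal_ideal (M : set R) : Prop :=
  [/\ ideal M, ~ M 1
    & forall I, ideal I -> M `<=` I -> ~ I 1 -> I = M].

Definition noetherian : Prop :=
  forall I, ideal I -> exists n, @generated_by R R^o I n.

Definition local (m : set R) : Prop :=
  maximal_ideal m /\ forall n, maximal_ideal n -> n = m.

Definition prime_chain (n : nat) : Prop :=
  exists P : nat -> set R,
    (forall i, (i <= n)%N -> prime_ideal (P i)) /\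
    (forall i, (i < n)%N -> P i `<` P i.+1).

Definition krull_dim (d : nat) : Prop :=
  prime_chain d /\ forall n, prime_chain n -> (n <= d)%N.

(* The sequence is x 0, ..., x n.-1. When m is the maximal ideal of a local
   ring, R / (x 0, ..., x n.-1) is automatically nonzero. *)
Definition regular_seq_in (m : set R) (n : nat) (x : nat -> R) : Prop :=
  forall i, (i < n)%N -> m (x i) /\
    forall a, @rspan R R^o i (fun j : 'I_i => x j) (x i * a) ->
              @rspan R R^o i (fun j : 'I_i => x j) a.

Definition depth (m : set R) (t : nat) : Prop :=
  (exists x, regular_seq_in m t x) /\
  forall n x, regular_seq_in m n x -> (n <= t)%N.

Definition cohen_macaulay_local (m : set R) (d : nat) : Prop :=
  [/\ noetherian, local m, krull_dim d & depth m d].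

(* Discrete valuation rings as local principal ideal domains, not fields. *)
Definition dvr : Prop :=
  [/\ GRing.integral_domain_axiom R,
      forall I, ideal I -> exists x, I = principal x
    & exists2 m, local m & m <> [set 0]].

(* A resolution  ... -> R^(n_1) -> R^(n_0) -> R/m -> 0  by finite free modules
   of row vectors, n_i = res_rank i: the differentials are right multiplications
   by the res_diff i, and the augmentation is right multiplication by res_aug
   followed by R -> R/m. *)
Record free_resolution_residue (m : set R) := FreeResolution {
  res_rank : nat -> nat;
  res_aug : 'cV[R]_(res_rank 0%N);
  res_diff : forall i, 'M[R]_(res_rank i.+1, res_rank i);
  aug_surj : forall a, exists v : 'rV_(res_rank 0%N),
    m ((v *m res_aug) 0 0 - a);
  aug_exact : forall v : 'rV_(res_rank 0%N),
    m ((v *m res_aug) 0 0) <-> exists w, v = w *m res_diff 0%N;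
  diff_exact : forall i (v : 'rV_(res_rank i.+1)),
    v *m res_diff i = 0 <-> exists w, v = w *m res_diff i.+1 }.

Section Ext.
Variables (m : set R) (F : free_resolution_residue m).

(* Hom_R(R^(n_i), R) is identified with column vectors, so that the cochain
   complex Hom_R(F, R) has the left multiplications by res_diff i as maps. *)
Definition cocycle (i : nat) : set 'cV[R]_(res_rank F i) :=
  [set c | res_diff F i *m c = 0].

Definition coboundary (i : nat) : set 'cV[R]_(res_rank F i) :=
  match i with
  | 0%N => [set 0]
  | j.+1 => [set res_diff F j *m b | b in [set: 'cV[R]_(res_rank F j)]]
  end.

End Ext.
Arguments cocycle {m} F i.
Arguments coboundary {m} F i.

(* dim over R/m of Ext^i_R(R/m, R), the cohomology of Hom_R(F, R) for a free
   resolution F of R/m; it does not depend on the choice of F. *)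
Definition ext_residue_dim (m : set R) (i r : nat) : Prop :=
  exists F : free_resolution_residue m,
    residue_dim m (cocycle F i) (coboundary F i) r.

Definition cm_type (m : set R) (r : nat) : Prop :=
  exists2 t, depth m t & ext_residue_dim m t r.

End Rings.

Section TotalFractions.
Variables (R : comNzRingType) (Q : comUnitAlgType R).

Definition total_fraction_ring : Prop :=
  [/\ injective (fun a : R => a%:A : Q),
      forall s : R, GRing.lreg s -> (s%:A : Q) \is a GRing.unit
    & forall q : Q, exists a s : R, GRing.lreg s /\ q = a%:A / s%:A].

Definition image_in (I : set R) : set Q := [set a%:A | a in I].

End TotalFractions.
Arguments image_in {R} Q I.

(* Main.v *)
Require Import Defs.
From HB Require Import structures.
From mathcomp Require Import all_boot all_order all_algebra.
From mathcomp Require Import boolp classical_sets functions.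
From mathcomp Require Import ring.

Set Implicit Arguments.
Unset Strict Implicit.
Unset Printing Implicit Defensive.

Import GRing.Theory.
Local Open Scope classical_set_scope.
Local Open Scope ring_scope.

(** Fix a regular element [x] of [m] (one exists since the depth is one), and
    write [A] for [m :_Q m].

    The inclusion [R :_Q m `<=` A] is where discrete valuation rings are
    excluded: if [q * m] lies in [R] but not in [m], it contains a unit of [R],
    so [q * t = 1] for some [t] in [m], and [m] is generated by the regular
    element [t].  The ideals [(t^n)] then have intersection zero
    ([regular_power_bound]) and [R] is a discrete valuation ring
    ([dvr_of_principal_regular]).  Hence [A = R :_Q m] ([colon_max]), and
    multiplication by [x] maps this module onto [(x) :_R m] ([colon_regular]).
    An endomorphism [f] of [m] is the multiplication by [f(x) / x], because
    [x f(y) = f(x y) = y f(x)] ([hom_endo]).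

    As [x A = (x) :_R m] and [x R = (x)], the module [A / R] is
    [((x) :_R m) / (x)], which is isomorphic to [Ext^1(R/m, R)] and so is a
    vector space of dimension [r] over [R/m].  The isomorphism is computed in
    the given free resolution of [R/m] ([residue_dim_colon]), by means of a
    matrix whose product with the first differential is multiplication by [x].
    Finally [m A] is contained in [m] and contains it, since [1] is in [A]; so
    [A / m A = A / m] is an extension of [A / R] by [R / m] and has dimension
    [r + 1].  Concretely, [1] and lifts of a basis of [A / R] generate [A], and
    their relations have coefficients in [m]; over a local ring this makes them
    a minimal system of generators ([min_gens_of_relations]). *)

(** * Submodules and ideals *)

Section Submodules.
Variables (R : comNzRingType) (V : lmodType R) (M : set V).
Hypothesis M_sub : submodule M.

Lemma submodule0 : M 0. Proof. by case: M_sub. Qed.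

Lemma submoduleD u v : M u -> M v -> M (u + v).
Proof. by case: M_sub => _ + _; apply. Qed.

Lemma submoduleZ a u : M u -> M (a *: u).
Proof. by case: M_sub => _ _; apply. Qed.

Lemma submoduleB u v : M u -> M v -> M (u - v).
Proof.
by move=> Mu Mv; rewrite -scaleN1r; apply/submoduleD/submoduleZ.
Qed.

Lemma submodule_sum (I : Type) (s : seq I) (P : pred I) (F : I -> V) :
  (forall i, P i -> M (F i)) -> M (\sum_(i <- s | P i) F i).
Proof.
by move=> MF; apply: big_ind => //; [exact: submodule0 | exact: submoduleD].
Qed.

End Submodules.

Lemma rspan_gen (R : comNzRingType) (V : lmodType R) n (v : 'I_n -> V) i :
  rspan v (v i).
Proof.
exists (fun j => (j == i)%:R).
rewrite (bigD1 i) //= eqxx scale1r big1 ?addr0 // => j /negPf->.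
by rewrite scale0r.
Qed.

Lemma ideal0 (R : comNzRingType) (I : set R) : ideal I -> I 0.
Proof. exact: (@submodule0 R R^o). Qed.

Lemma idealM (R : comNzRingType) (I : set R) (a u : R) :
  ideal I -> I u -> I (a * u).
Proof. by move=> I_id; exact: (@submoduleZ R R^o). Qed.

Lemma idealB (R : comNzRingType) (I : set R) (u v : R) :
  ideal I -> I u -> I v -> I (u - v).
Proof. by move=> I_id; exact: (@submoduleB R R^o). Qed.

Lemma idealD (R : comNzRingType) (I : set R) (u v : R) :
  ideal I -> I u -> I v -> I (u + v).
Proof. by move=> I_id; exact: (@submoduleD R R^o). Qed.

Lemma ideal_principal (R : comNzRingType) (x : R) : ideal (principal x).
Proof.
split=> [|u v [a _ <-] [b _ <-]|c u [a _ <-]].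
- by exists 0; rewrite // mulr0.
- by exists (a + b); rewrite // mulrDr.
- by exists (c * a) => //; rewrite mulrCA.
Qed.

Lemma lregI (R : comNzRingType) (x a b : R) :
  GRing.lreg x -> x * a = x * b -> a = b.
Proof. by move=> x_reg; apply: x_reg. Qed.

(** * Local rings whose maximal ideal is principal *)

Section Local.
Variables (R : comNzRingType) (m : set R).
Hypothesis m_local : local m.

Lemma local_ideal : ideal m. Proof. by case: m_local => -[]. Qed.

Lemma local_proper : ~ m 1. Proof. by case: m_local => -[]. Qed.

(** In the hypothesis [local m], uniqueness is among maximal ideals only, so
    Zorn's lemma has to supply a maximal ideal above [I]. *)
Lemma local_sub I : ideal I -> ~ I 1 -> I `<=` m.
Proof.
move=> I_id I1; pose P X := forall y, X y -> [/\ ideal X, I `<=` X & ~ X 1].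
have [F FP Ftot|N [PN Nmax]] := @Zorn_bigcup R P.
  (* [P] holds vacuously at [set0], the union of the empty chain; the element
     [y] of the union provides a nonempty member of the chain. *)
  move=> y [X FX Xy]; have [X_id IX X1] := FP _ FX _ Xy; split.
  - split=> [|u v [U FU Uu] [W FW Ww]|a u [U FU Uu]].
    + by exists X => //; case: X_id.
    + have [U_id _ _] := FP _ FU _ Uu; have [W_id _ _] := FP _ FW _ Ww.
      case: (Ftot _ _ FU FW) => sUW.
        by exists W => //; apply: idealD => //; exact: sUW.
      by exists U => //; apply: idealD => //; exact: sUW.
    + have [U_id _ _] := FP _ FU _ Uu.
      by exists U => //; apply: idealM.
  - by move=> z /IX Xz; exists X.
  - by case=> U FU U1; have [] := FP _ FU _ U1.
(* A maximal [N] could still be empty, hence not an ideal; it is not, as [I]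
   is larger than [set0]. *)
have PI : P I by move=> y _; split.
have N0 : N 0.
  apply: contrapT => N0; apply: (Nmax I) PI.
  split=> [y /PN [N_id _ _]|/(_ 0 (ideal0 I_id)) //].
  by case: N0; exact: ideal0 N_id.
have [N_id IN N1] := PN _ N0.
suff <- : N = m by [].
apply: (proj2 m_local); split=> // J J_id NJ J1.
apply: contrapT => NJneq; apply: (Nmax J).
  by split=> // JN; apply: NJneq; apply/seteqP.
by move=> y _; split=> // z /IN /NJ.
Qed.

Lemma local_unit a : ~ m a -> exists b, a * b = 1.
Proof.
move=> ma; apply: contrapT => a_nunit; apply: ma.
apply: (local_sub (@ideal_principal R a)) => [[b _ ab]|].
  by apply: a_nunit; exists b.
by exists 1; rewrite // mulr1.
Qed.

End Local.

(** Krull's intersection theorem for a principal ideal.  If [a = y^n b_n] for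
    all [n], regularity of [y] gives [b_n = y b_{n+1}], so the ideals [(b_n)]
    form a chain.  It is stationary, so [b_{K+1} = b_K c = y c b_{K+1}] for
    some [K] and [c]; as [1 - y c] is a unit, [b_{K+1}] and [a] vanish. *)
Lemma regular_power_bound (R : comNzRingType) (m : set R) (y a : R) :
  noetherian R -> local m -> m y -> GRing.lreg y ->
  (forall n, exists b, a = y ^+ n * b) -> a = 0.
Proof.
move=> R_noeth m_local my y_reg /choice [b ab].
have bS n : b n = y * b n.+1.
  by apply: (lregI (lregX (n := n) y_reg)); rewrite -ab (ab n.+1) exprSr mulrA.
have bD k n : b n = y ^+ k * b (n + k)%N.
  elim: k => [|k IHk]; first by rewrite mul1r addn0.
  by rewrite IHk addnS bS exprSr mulrA.
pose I : set R := [set u | exists n, principal (b n) u].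
have prin_le n k u : (n <= k)%N -> principal (b n) u -> principal (b k) u.
  move=> nk [c _ <-]; exists (y ^+ (k - n) * c) => //.
  by rewrite [b n](bD (k - n)%N) subnKC // mulrA [b k * _]mulrC.
have I_id : ideal I.
  split=> [|u v [n bu] [k bv]|c u [n bu]].
  - by exists 0%N; exact: ideal0 (ideal_principal _).
  - exists (maxn n k); apply: idealD (ideal_principal _) _ _.
      exact: prin_le (leq_maxl _ _) bu.
    exact: prin_le (leq_maxr _ _) bv.
  - by exists n; apply: idealM (ideal_principal _) _.
have [n [v Iv]] := R_noeth I I_id.
have vI i : I (v i) by rewrite Iv; exact: (@rspan_gen R R^o).
have /choice [N vN] := vI.
pose K := \max_i N i.
have IK u : I u -> principal (b K) u.
  rewrite Iv => -[c ->].
  apply: (@submodule_sum R R^o _ (ideal_principal _)) => i _.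
  apply: (@submoduleZ R R^o _ (ideal_principal _)).
  exact: prin_le (leq_bigmax i) (vN i).
have /IK[c _ bc] : I (b K.+1) by exists K.+1, 1; rewrite // mulr1.
have [|d cyd] := @local_unit R m m_local (1 - y * c).
  move=> mc; apply: (local_proper m_local).
  rewrite -(subrK (y * c) 1); apply: idealD => //; first exact: local_ideal.
  by rewrite mulrC; apply: idealM => //; exact: local_ideal.
rewrite (ab K).
have -> : b K = 0.
  by rewrite -[b K]mulr1 -cyd mulrA mulrBr mulr1 mulrCA bc -bS subrr mul0r.
by rewrite mulr0.
Qed.

(** Every nonzero element is a unit times a power of [y]: otherwise it could be
    divided by [y] indefinitely. *)
Lemma dvr_of_principal_regular (R : comNzRingType) (m : set R) (y : R) :
  noetherian R -> local m -> GRing.lreg y -> m = principal y -> dvr R.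
Proof.
move=> R_noeth m_local y_reg m_y.
have my : m y by rewrite m_y; exists 1; rewrite // mulr1.
have factor a : a <> 0 -> exists n b c, a = y ^+ n * b /\ b * c = 1.
  move=> a0; apply: contrapT => no_factor; apply: a0.
  apply: (regular_power_bound R_noeth m_local my y_reg).
  elim=> [|n [b ab]]; first by exists a; rewrite mul1r.
  have : m b.
    apply: contrapT => /(local_unit m_local)[c bc].
    by apply: no_factor; exists n, b, c.
  by rewrite m_y => -[c _ yc]; exists c; rewrite ab -yc exprSr mulrA.
split.
- move=> a b ab; case: eqP => //= /factor[n [u [c [a_eq uc]]]].
  apply/eqP; rewrite -[b]mul1r -uc mulrAC.
  suff -> : u * b = 0 by rewrite mul0r.
  by apply: (lregI (lregX (n := n) y_reg)); rewrite mulrA -a_eq ab mulr0.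
- move=> I I_id.
  have [I0|/existsNP[a /not_implyP[Ia /factor a_fac]]] :=
    pselect (forall a, I a -> a = 0).
    exists 0; apply/seteqP; split=> [a /I0 ->|_ [c _ <-]].
      by exists 0; rewrite // mulr0.
    by rewrite mul0r; exact: ideal0 I_id.
  have exI : exists n, `[< I (y ^+ n) >].
    have [n [u [c [a_eq uc]]]] := a_fac; exists n; apply/asboolP.
    by rewrite -[y ^+ n]mulr1 -uc mulrA -a_eq mulrC; apply: idealM.
  case: (ex_minnP exI) => n /asboolP In n_min; exists (y ^+ n).
  apply/seteqP; split=> [b Ib|_ [c _ <-]]; last by rewrite mulrC; apply: idealM.
  have [->|/factor[k [u [c [b_eq uc]]]]] := pselect (b = 0).
    by exists 0; rewrite // mulr0.
  have /n_min /subnKC nk : `[< I (y ^+ k) >].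
    apply/asboolP; rewrite -[y ^+ k]mulr1 -uc mulrA -b_eq mulrC.
    exact: idealM.
  by exists (y ^+ (k - n) * u); rewrite // mulrA -exprD nk b_eq.
- exists m => // m0; move: my; rewrite m0 => y0.
  have /eqP := @oner_neq0 R; apply; apply: (lregI y_reg).
  by rewrite (y0 : y = 0) !mul0r.
Qed.

(** * The first Ext module of the residue field *)

Section Colon.
Variables (R : comNzRingType) (m : set R) (x : R).
Hypotheses (m_ideal : ideal m) (mx : m x) (x_reg : GRing.lreg x).
Variable F : free_resolution_residue m.

Let eps := res_aug F.
Let d0 := res_diff F 0%N.
Let d1 := res_diff F 1%N.

Lemma res_diff_comp : d1 *m d0 = 0.
Proof.
apply/row_matrixP => i; rewrite row_mul row0.
by apply/diff_exact; exists (delta_mx 0 i); rewrite rowE.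
Qed.

Lemma aug_res_diff i : m ((d0 *m eps) i 0).
Proof.
have -> : (d0 *m eps) i 0 = (row i d0 *m eps) 0 0.
  by rewrite -row_mul [RHS]mxE.
by apply/aug_exact; exists (delta_mx 0 i); rewrite rowE.
Qed.

(** Since [x] kills [R/m], multiplication by [x] on the resolution is null
    homotopic modulo the augmentation; [W] is the degree zero part of a
    homotopy. *)
Lemma res_homotopy : exists W, W *m d0 = x%:M.
Proof.
have /choice[w wP] i : exists w, row i x%:M = w *m d0.
  apply/aug_exact; rewrite -row_mul mxE mul_scalar_mx mxE mulrC.
  exact: idealM.
exists (\matrix_i w i); apply/row_matrixP => i.
by rewrite row_mul rowK wP.
Qed.

(** After inverting [x], every cocycle is the coboundary of [x^-1 W c]: the rows
    of [d0 W - x] are killed by [d0], so they are combinations of rows of [d1],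
    and the latter kills [c]. *)
Lemma homotopy_cocycle W c :
  W *m d0 = x%:M -> @cocycle R m F 1 c -> d0 *m (W *m c) = x *: c.
Proof.
move=> Wd0 d1c.
have /choice[u uP] i : exists u, row i (d0 *m W - x%:M) = u *m d1.
  apply/diff_exact; rewrite -row_mul mulmxBl -mulmxA Wd0.
  by rewrite mul_mx_scalar mul_scalar_mx subrr row0.
have : (d0 *m W - x%:M) *m c = 0.
  apply/row_matrixP => i.
  by rewrite row_mul uP -mulmxA (d1c : d1 *m c = 0) mulmx0 row0.
by rewrite mulmxBl mul_scalar_mx mulmxA => /eqP; rewrite subr_eq0 => /eqP.
Qed.

Lemma scalemx_reg p q (A B : 'M[R]_(p, q)) : x *: A = x *: B -> A = B.
Proof.
move=> eAB; apply/matrixP => i j; apply: (lregI x_reg).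
by have /matrixP/(_ i j) := eAB; rewrite !mxE.
Qed.

(** [Ext^1(R/m, R)] is isomorphic to [((x) :_R m) / (x)].  A cocycle [c] is a
    homomorphism to [R] from the kernel [K] of the map from [R^(n_0)] to [R/m]
    given by [eps]; its extension to fractions is [x^-1 W c].  As [R^(n_0)] is
    spanned by [K] and any [v0] lifting [1], the class of [c] is determined by
    the value of [W c] at [v0], modulo [x].  In the opposite direction, [z]
    goes to the cocycle [x^-1 z d0 eps]. *)
Lemma residue_dim_colon r :
  residue_dim m (@cocycle R m F 1) (@coboundary R m F 1) r ->
  @residue_dim R R^o m (colon (principal x) m) (principal x) r.
Proof.
case=> b [bZ b_gen b_free].
have [W Wd0] := res_homotopy.
have [v0 v0P] := aug_surj F 1.
pose mu := (v0 *m eps) 0 0 - 1.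
have m_mu : m mu by exact: v0P.
have v0eps : v0 *m eps = (1 + mu)%:M.
  by rewrite [LHS]mx11_scalar /mu addrC subrK.
pose beta i := (v0 *m (W *m b i)) 0 0.
have sum_beta (a : 'I_r -> R) :
    \sum_i (a i : R) *: (beta i : R^o) =
      (v0 *m (W *m (\sum_i a i *: b i))) 0 0.
  rewrite !mulmx_sumr summxE; apply: eq_bigr => i _.
  by rewrite -!scalemxAr [RHS]mxE.
exists beta; split.
- move=> i y my.
  have /aug_exact[w wP] : m (((y *: v0) *m eps) 0 0).
    by rewrite -scalemxAl mxE mulrC; apply: idealM.
  exists ((w *m b i) 0 0) => //.
  have /matrixP/(_ 0 0) : y *: v0 *m (W *m b i) = x *: (w *m b i).
    by rewrite wP -mulmxA (homotopy_cocycle Wd0 (bZ i)) scalemxAr.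
  by rewrite -scalemxAl mxE [X in _ = X -> _]mxE mulrC => <-.
- move=> z z_colon.
  have /choice[c cP] i : exists c, x * c = z * (d0 *m eps) i 0.
    by have [c _ xc] := z_colon _ (aug_res_diff i); exists c.
  pose C := \col_i c i.
  have xC : x *: C = z *: (d0 *m eps).
    by apply/matrixP => i j; rewrite (ord1 j) [LHS]mxE [C i 0]mxE cP [RHS]mxE.
  have C_cocycle : @cocycle R m F 1 C.
    apply: scalemx_reg; rewrite scaler0 scalemxAr xC -scalemxAr mulmxA.
    by rewrite res_diff_comp mul0mx scaler0.
  have [a [h _ hP]] := b_gen _ C_cocycle.
  have d0h : d0 *m h = C - \sum_i a i *: b i by [].
  exists a.
  (* Both sides have the image [x *: C] under [d0], which is injective because
     [W d0 = x]. *)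
  have x_eq : z *: eps = W *m (\sum_i a i *: b i) + x *: h.
    apply: scalemx_reg.
    rewrite scalerDr -[x *: (x *: h)]mul_scalar_mx -Wd0 -mulmxA -scalemxAr d0h.
    rewrite scalerBr xC mulmxBr -!scalemxAr mulmxA Wd0 mul_scalar_mx.
    by rewrite addrC subrK scalerA scalerA mulrC.
  have /matrixP/(_ 0 0) := congr1 (mulmx v0) x_eq.
  rewrite -scalemxAr v0eps mulmxDr mxE [X in _ = X]mxE -sum_beta => z_eq.
  have [c' _ xc'] := z_colon _ m_mu.
  exists ((v0 *m h) 0 0 - c') => //.
  rewrite mulrBr xc'.
  move: z_eq; rewrite -scalemxAr [_%:M 0 0]mxE eqxx mulr1n.
  rewrite [(x *: (v0 *m h)) 0 0]mxE.
  set S := \sum_i _; set T := _ 0 0 => z_eq.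
  have -> : x * T = z * (1 + mu) - S by rewrite z_eq [RHS]addrC addKr.
  by rewrite mulrDr mulr1 addrAC addrK.
- move=> a [s _ sP].
  apply: b_free.
  pose B := \sum_i a i *: b i.
  have B_cocycle : @cocycle R m F 1 B.
    rewrite /cocycle /= mulmx_sumr big1 // => i _.
    by rewrite -scalemxAr (bZ i : _ = 0) scaler0.
  have d0WB := homotopy_cocycle Wd0 B_cocycle.
  have /choice[h hP] j : exists h, (W *m B) j 0 = x * h.
    (* The [j]-th basis vector differs by an element of [K] from its multiple
       of [v0]. *)
    have /aug_exact[w wP] : m (((delta_mx 0 j - eps j 0 *: v0) *m eps) 0 0).
      rewrite mulmxBl -scalemxAl v0eps -rowE !mxE eqxx mulr1n.
      by rewrite mulrDr mulr1 opprD addrA subrr sub0r -mulNr; apply: idealM.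
    exists ((w *m B) 0 0 + eps j 0 * s).
    have : (W *m B) j 0 - eps j 0 * (v0 *m (W *m B)) 0 0 = x * (w *m B) 0 0.
      have /matrixP/(_ 0 0) := congr1 (mulmx^~ (W *m B)) wP.
      rewrite /= -mulmxA d0WB mulmxBl -scalemxAl -rowE -scalemxAr.
      by rewrite !mxE.
    rewrite -sum_beta -sP => /eqP; rewrite subr_eq => /eqP ->.
    by rewrite mulrDr mulrCA.
  exists (\col_j h j) => //; apply: scalemx_reg; rewrite scalemxAr -d0WB.
  congr (_ *m _); apply/matrixP => i j.
  by rewrite (ord1 j) hP !mxE.
Qed.

End Colon.

(** * Minimal systems of generators over a local ring *)

Lemma det_mod_ideal (R : comNzRingType) (I : set R) n (A B : 'M[R]_n) :
  ideal I -> (forall i j, I (A i j - B i j)) -> I (\det A - \det B).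
Proof.
move=> I_id AB; rewrite /determinant.
apply: (big_ind2 (fun a b => I (a - b))) => [|a b c d Iab Icd|s _].
- by rewrite subrr; exact: ideal0 I_id.
- by rewrite opprD addrACA; apply: idealD.
rewrite -mulrBr; apply: idealM => //.
apply: (big_ind2 (fun a b => I (a - b))) => [|a b c d Iab Icd|i _ //].
- by rewrite subrr; exact: ideal0 I_id.
have -> : a * c - b * d = c * (a - b) + b * (c - d) by ring.
by apply: idealD => //; apply: idealM.
Qed.

Section MinGens.
Variables (R : comNzRingType) (m : set R) (V : lmodType R).
Hypothesis m_local : local m.

(** Writing [u] in terms of another generating family [v] of size [k], and
    conversely, factors through [R^k] a square matrix congruent to the identity
    modulo [m].  Its determinant is a
    unit, so the identity matrix of size [n] itself factors through [R^k]. *)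
Lemma min_gens_of_relations (M : set V) n (u : 'I_n -> V) :
  M = rspan u ->
  (forall a : 'I_n -> R, \sum_i a i *: u i = 0 -> forall i, m (a i)) ->
  min_gens M n.
Proof.
move=> Mu u_rel; split=> [|k [v Mv]]; first by exists u.
have /choice[S uS] i : rspan v (u i) by rewrite -Mv Mu; exact: rspan_gen.
have /choice[T vT] i : rspan u (v i) by rewrite -Mu Mv; exact: rspan_gen.
pose P : 'M[R]_(n, k) := \matrix_(i, j) S i j.
pose N : 'M[R]_(k, n) := \matrix_(j, l) T j l.
have PN_mod i l : m ((1%:M : 'M[R]_n) i l - (P *m N) i l).
  apply: (u_rel (fun l => (1%:M : 'M[R]_n) i l - (P *m N) i l)).
  under eq_bigr => j _ do rewrite scalerBl.
  rewrite sumrB (bigD1 i) //= mxE eqxx scale1r.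
  rewrite [X in _ + X - _]big1 => [|j /negPf ji].
    2: by rewrite mxE eq_sym ji scale0r.
  apply/eqP; rewrite addr0 subr_eq0 {1}uS; apply/eqP.
  under [RHS]eq_bigr => j _ do rewrite mxE scaler_suml.
  rewrite exchange_big /=; apply: eq_bigr => j _.
  by rewrite {1}vT scaler_sumr; apply: eq_bigr => l' _; rewrite scalerA !mxE.
have m_id := local_ideal m_local.
have /(local_unit m_local)[c Dc] : ~ m (\det (P *m N)).
  move=> mD; apply: (local_proper m_local).
  rewrite -[1](subrK (\det (P *m N))); apply: idealD => //.
  by rewrite -{1}(det1 _ n); apply: det_mod_ideal.
apply: (@mulmx1_min _ _ _ P (N *m (c *: \adj (P *m N)))).
by rewrite mulmxA -scalemxAr mul_mx_adj scale_scalar_mx mulrC Dc.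
Qed.

End MinGens.

(** * The endomorphism ring of the maximal ideal *)

Lemma lin_homZ (R : comNzRingType) (V W : lmodType R) (M : set V) (N : set W)
    (f : M -> N) (a : R) (u w : M) :
  submodule M -> lin_hom f -> \val w = a *: \val u ->
  \val (f w) = a *: \val (f u).
Proof.
move=> M_sub f_lin w_eq.
pose o : M := exist _ 0 (mem_set (submodule0 M_sub)).
have fo : \val (f o) = 0.
  by rewrite (f_lin (-1) o o o) ?scaleN1r ?addNr.
by rewrite (f_lin a u o) ?fo ?addr0.
Qed.

Section Fractions.
Variables (R : comNzRingType) (Q : comUnitAlgType R) (m : set R).
Hypotheses (R_noeth : noetherian R) (m_local : local m) (R_ndvr : ~ dvr R).
Hypothesis Q_frac : total_fraction_ring Q.

Local Notation mQ := (image_in Q m).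
Local Notation A := (colon mQ mQ).

Let m_ideal : ideal m := local_ideal m_local.

Lemma frac_inj (a b : R) : a%:A = b%:A :> Q -> a = b.
Proof. by case: Q_frac => inj _ _; apply: inj. Qed.

Lemma frac_unit (x : R) : GRing.lreg x -> (x%:A : Q) \is a GRing.unit.
Proof. by case: Q_frac => _ unitP _ /unitP. Qed.

Lemma algM (a b : R) : (a * b)%:A = a%:A * b%:A :> Q.
Proof. exact: (rmorphM (GRing.in_alg Q)). Qed.

Lemma image_in_max (a : R) : mQ a%:A -> m a.
Proof. by case=> b mb /frac_inj <-. Qed.

(** If [q * y] were a unit of [R] for some [y] in [m], the inverse of [q] would
    lie in [m] and generate it. *)
Lemma colon_max (q : Q) :
  (forall y, m y -> exists c : R, q * y%:A = c%:A) -> A q.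
Proof.
move=> qR _ [y my <-]; have [c qy] := qR y my; rewrite qy; exists c => //.
apply: contrapT => /(local_unit m_local)[d cd]; apply: R_ndvr.
have qt : q * (y * d)%:A = 1 by rewrite algM mulrA qy -algM cd scale1r.
apply: (@dvr_of_principal_regular R m (y * d)) => // [a b ab|].
  apply: frac_inj; have := congr1 (fun z => q * z%:A) ab.
  by rewrite /= !(algM (y * d)) !mulrA qt !mul1r.
apply/seteqP; split=> [z mz|_ [c' _ <-]].
  have [e qz] := qR z mz; exists e => //; apply: frac_inj.
  by rewrite algM -qz mulrA [_ * q]mulrC qt mul1r.
by rewrite -mulrA mulrC; apply: idealM.
Qed.

Lemma colon_regular (x : R) : m x -> GRing.lreg x ->
  A = [set (x%:A)^-1 * b | b in image_in Q (colon (principal x) m)].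
Proof.
move=> mx x_reg; have x_unit := frac_unit x_reg.
apply/seteqP; split=> [q Aq|_ [_ [b b_colon <-] <-]].
  have [b mb qx] : mQ (q * x%:A) by apply: Aq; exists x.
  exists b%:A; last by rewrite qx mulrC mulrK.
  exists b => // y my; have [c mc qy] : mQ (q * y%:A) by apply: Aq; exists y.
  exists c => //; apply: frac_inj.
  by rewrite !algM qx qy mulrCA mulrA.
apply: colon_max => y my; have [c _ xc] := b_colon y my.
by exists c; rewrite -mulrA -algM -xc algM mulKr.
Qed.

Lemma submodule_endo : submodule A.
Proof.
split=> [y _|p q Ap Aq y my|a q Aq y my].
- by rewrite mul0r; exists 0; [exact: ideal0 | rewrite scale0r].
- have [b mb p_eq] := Ap y my; have [c mc q_eq] := Aq y my.
  by exists (b + c); [exact: idealD | rewrite mulrDl -p_eq -q_eq scalerDl].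
- have [b mb q_eq] := Aq y my; exists (a * b); first exact: idealM.
  by rewrite -scalerAl -q_eq algM mulr_algl.
Qed.

Lemma hom_endo (x : R) : m x -> GRing.lreg x ->
  exists phi : (m -> m) -> Q,
    set_bij (@lin_hom R R^o R^o m m) A phi /\
    (forall f, @lin_hom R R^o R^o m m f -> forall y : m,
       (\val (f y))%:A = phi f * (\val y)%:A).
Proof.
move=> mx x_reg; have x_unit := frac_unit x_reg.
pose x0 : m := exist _ x (mem_set mx).
pose phi (f : m -> m) : Q := (\val (f x0))%:A / x%:A.
have phiE f : @lin_hom R R^o R^o m m f -> forall y : m,
    (\val (f y))%:A = phi f * (\val y)%:A.
  move=> f_lin y.
  have mxy : m (x * \val y) by rewrite mulrC; apply: idealM.
  pose w : m := exist _ (x * \val y) (mem_set mxy).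
  have fw1 : \val (f w) = x * \val (f y).
    exact: (@lin_homZ R R^o R^o m m f x y w).
  have fw2 : \val (f w) = \val y * \val (f x0).
    by apply: (@lin_homZ R R^o R^o m m f _ x0 w) => //; rewrite /= mulrC.
  rewrite /phi mulrAC [_ * (\val y)%:A]mulrC -algM -fw2 fw1 algM.
  by rewrite mulrC mulKr.
exists phi; split=> //; split.
- move=> f f_lin _ [a ma <-].
  pose w : m := exist _ a (mem_set ma).
  by exists (\val (f w)); [exact: set_mem (valP (f w)) | exact: phiE].
- move=> f g /set_mem f_lin /set_mem g_lin fg; apply/funext => y.
  apply: val_inj.
  apply: frac_inj.
  by rewrite (phiE f f_lin) (phiE g g_lin) fg.
- move=> q Aq.
  have /choice[f fE] (y : m) : exists z : m, (\val z)%:A = q * (\val y)%:A.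
    have [z mz qy] : mQ (q * (\val y)%:A).
      by apply: Aq; exists (\val y) => //; exact: set_mem (valP y).
    by exists (exist _ z (mem_set mz)).
  have f_lin : @lin_hom R R^o R^o m m f.
    move=> a u v w w_eq; apply: frac_inj.
    have algZ (c : R^o) : (a *: c : R)%:A = a%:A * c%:A :> Q by exact: algM.
    by rewrite fE w_eq !scalerDl !algZ !fE mulrDr mulrCA.
  exists f => //.
  by rewrite /phi fE /= mulrK.
Qed.

(** The generators are [1] and the [b i / x], where [b] induces a basis of
    [((x) :_R m) / (x)].  In a relation, clearing the denominator [x] shows that
    the coefficients of the [b i / x] are in [m]; the coefficient of [1] is
    then in [m A], which is contained in [m]. *)
Lemma min_gens_endo (x : R) r : m x -> GRing.lreg x ->
  @residue_dim R R^o m (colon (principal x) m) (principal x) r ->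
  min_gens A r.+1.
Proof.
move=> mx x_reg [b [b_colon b_gen b_free]]; have x_unit := frac_unit x_reg.
pose q i : Q := (b i : R)%:A / x%:A.
pose u i := if unlift ord0 i is Some j then q j else 1.
have Aq i : A (q i).
  rewrite (colon_regular mx x_reg).
  by exists (b i)%:A; [exists (b i) | exact: mulrC].
have sum_u (a : 'I_r.+1 -> R) :
    \sum_i a i *: u i = (a ord0)%:A + \sum_i a (lift ord0 i) *: q i.
  rewrite big_ord_recl /u unlift_none; congr (_ + _).
  by apply: eq_bigr => i _; rewrite liftK.
have sum_q (a : 'I_r -> R) :
    \sum_i a i *: q i = (\sum_i a i * b i)%:A / x%:A.
  rewrite scaler_suml mulr_suml; apply: eq_bigr => i _.
  by rewrite algM -mulrA [RHS]mulr_algl.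
have m_sub : @submodule R Q mQ.
  split=> [|_ _ [c mc <-] [d md <-]|c _ [d md <-]].
  - by exists 0; [exact: ideal0 | rewrite scale0r].
  - by exists (c + d); [exact: idealD | rewrite scalerDl].
  - by exists (c * d); [exact: idealM | rewrite scalerA].
apply: (min_gens_of_relations m_local (u := u)) => [|a].
  apply/seteqP; split=> [p Ap|_ [a ->]].
    have := Ap; rewrite (colon_regular mx x_reg) => -[_ [z z_colon <-] <-].
    have [a [c _ zE]] := b_gen z z_colon.
    exists (fun i => if unlift ord0 i is Some j then a j else c).
    rewrite sum_u unlift_none; under eq_bigr => i _ do rewrite liftK.
    rewrite sum_q.
    have -> : z = x * c + \sum_i a i * b i by rewrite zE subrK.
    by rewrite scalerDl algM mulrDr mulKr // [_ * _^-1]mulrC.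
  apply: (submodule_sum submodule_endo) => i _.
  apply: (submoduleZ submodule_endo).
  by rewrite /u; case: unliftP => [j _|_ y]; [exact: Aq | rewrite mul1r].
rewrite sum_u => a_rel.
have ma i : m (a (lift ord0 i)).
  apply: (b_free (fun i => a (lift ord0 i))); exists (- a ord0) => //.
  apply: frac_inj; rewrite algM.
  move: a_rel; rewrite sum_q => a_rel.
  apply: (mulIr (_ : (x%:A : Q)^-1 \is a GRing.unit)); first by rewrite unitrV.
  rewrite mulrC mulKr // scaleNr; apply/eqP.
  by rewrite eq_sym -addr_eq0 addrC a_rel.
have ma0 : m (a ord0).
  apply: image_in_max.
  move/eqP: a_rel; rewrite addr_eq0 => /eqP ->; rewrite -scaleN1r.
  apply: (submoduleZ m_sub); apply: (submodule_sum m_sub) => i _.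
  by rewrite -mulr_algl mulrC; apply: Aq; exists (a (lift ord0 i)).
by move=> i; case: (unliftP ord0 i) => [j ->|->].
Qed.

End Fractions.

Theorem theorem12p1 (R : comNzRingType) (m : set R) (r : nat)
    (Q : comUnitAlgType R)
    (R_cm : cohen_macaulay_local m 1)
    (R_type : cm_type m r)
    (R_ndvr : ~ dvr R)
    (Q_frac : total_fraction_ring Q) :
  let mQ : set Q := image_in Q m in
  let A : set Q := colon mQ mQ in
  [/\ exists phi : (m -> m) -> Q,
        set_bij (@lin_hom R R^o R^o m m) A phi /\
        (forall f, @lin_hom R R^o R^o m m f -> forall y : m,
           (\val (f y))%:A = phi f * (\val y)%:A),
      (forall x : R, m x -> GRing.lreg x ->
         A = [set (x%:A)^-1 * b | b in image_in Q (colon (principal x) m)])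
    & min_gens A r.+1].
Proof.
move=> mQ A.
have [R_noeth m_local _ [[s s_seq] s_max]] := R_cm.
have m_ideal := local_ideal m_local.
have [mx x_cancel] := s_seq 0%N isT.
have x_reg : GRing.lreg (s 0%N).
  move=> a b ab; apply/eqP; rewrite -subr_eq0; apply/eqP.
  have [|c ->] := x_cancel (a - b); last by rewrite big_ord0.
  by exists (fun=> 0); rewrite big_ord0 mulrBr ab subrr.
have [t [[s' s'_seq] s'_max] [F F_dim]] := R_type.
(* The depth is unique, so the type is the dimension of the first Ext
   module. *)
have t1 : t = 1%N.
  by apply/eqP; rewrite eqn_leq (s_max _ s') // (s'_max _ s).
rewrite {}t1 in F_dim; have F_colon := residue_dim_colon m_ideal mx x_reg F_dim.
split; first exact: hom_endo mx x_reg.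
  by move=> x mx' x_reg'; exact: colon_regular.
exact: min_gens_endo mx x_reg F_colon.
Qed.
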